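(* Let $C = \mathtt{while}(\varphi)\{B\} \in \mathsf{pWhile}$ and let $N, N' \geq 1$ be integers. Then: (1) If $I \in \mathbb{E}$ is a $\overline{\mathsf{wp}}^{N}$-superinvariant of $C$ w.r.t. $f \in \mathbb{E}_{meas}$, then $\mathsf{wp}[C](f) \sqsubseteq I$. (2) If $I \in \mathbb{E}^{\leq 1}$ is a $\underline{\mathsf{wlp}}^{N}$-subinvariant of $C$ w.r.t. $f \in \mathbb{E}^{\leq 1}_{meas}$, then $I \sqsubseteq \mathsf{wlp}[C](f)$. (3) If $I \in \mathbb{E}$ is a $\overline{\mathsf{wp}}^{N}$-superinvariant of $C$ w.r.t. $f \in \mathbb{E}_{meas}$ and $J \in \mathbb{E}^{\leq 1}$ is a $\underline{\mathsf{wlp}}^{N'}$-subinvariant of $C$ w.r.t. the constant expectation $1$, then for all states $\sigma$, $J(\sigma) > 0$ implies that $\mathsf{cwp}[C](f)(\sigma)$ is defined and $$\mathsf{cwp}[C](f)(\sigma) \leq \frac{I(\sigma)}{J(\sigma)}.$$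
   Context: Programs. Let $V$ be a finite set of program variables and $S=\mathbb{R}_{\ge 0}^V$ the set of states (functions $V\to\mathbb{R}_{\ge 0}$) with its Borel $\sigma$-algebra; $\sigma[x\mapsto\xi]$ is the state mapping $x$ to $\xi$ and agreeing with $\sigma$ elsewhere. Arithmetic expressions are measurable functions $E:S\to\mathbb{R}_{\ge 0}$; guards are measurable functions $\varphi:S\to\{\mathrm{true},\mathrm{false}\}$; $[\varphi]$ is the indicator function of $\varphi$. Programs in $\mathsf{pWhile}$ are generated by $C ::= \mathtt{skip} \mid \mathtt{diverge} \mid x:=E \mid \mathtt{observe}(\varphi) \mid x:\approx\mathtt{unif}_{[0,1]} \mid \mathtt{if}(\varphi)\{C\}\,\mathtt{else}\,\{C\} \mid \{C\}[p]\{C\} \mid C;C \mid \mathtt{while}(\varphi)\{C\}$, with $x\in V$, $E$ an arithmetic expression, $\varphi$ a guard, $p\in[0,1]\cap\mathbb{Q}$. Expectations. $\mathbb{E}$ is the set of all functions $S\to[0,\infty]$, $\mathbb{E}^{\le 1}$ the set of all functions $S\to[0,1]$; $\mathbb{E}_{meas}$, $\mathbb{E}^{\le 1}_{meas}$ are the subsets of Borel measurable functions. All are ordered pointwise by $\sqsubseteq$; $+$ and $\cdot$ are pointwise, with $0\cdot\infty=0$. $f[x/E]$ is the function $\sigma\mapsto f(\sigma[x\mapsto E(\sigma)])$. Exact transformers. $\mathsf{wp}[C]:\mathbb{E}_{meas}\to\mathbb{E}_{meas}$ is defined by: $\mathsf{wp}[\mathtt{skip}](f)=f$; $\mathsf{wp}[\mathtt{diverge}](f)=0$;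 $\mathsf{wp}[x:=E](f)=f[x/E]$; $\mathsf{wp}[x:\approx\mathtt{unif}_{[0,1]}](f)(\sigma)=\int_{[0,1]}f(\sigma[x\mapsto\xi])\,d\lambda(\xi)$ (Lebesgue integral); $\mathsf{wp}[\mathtt{observe}(\varphi)](f)=[\varphi]\cdot f$; $\mathsf{wp}[\mathtt{if}(\varphi)\{C_1\}\mathtt{else}\{C_2\}](f)=[\varphi]\cdot\mathsf{wp}[C_1](f)+[\neg\varphi]\cdot\mathsf{wp}[C_2](f)$; $\mathsf{wp}[\{C_1\}[p]\{C_2\}](f)=p\cdot\mathsf{wp}[C_1](f)+(1-p)\cdot\mathsf{wp}[C_2](f)$; $\mathsf{wp}[C_1;C_2](f)=\mathsf{wp}[C_1](\mathsf{wp}[C_2](f))$; $\mathsf{wp}[\mathtt{while}(\varphi)\{B\}](f)$ is the least fixed point of $Y\mapsto[\neg\varphi]\cdot f+[\varphi]\cdot\mathsf{wp}[B](Y)$. $\mathsf{wlp}[C]:\mathbb{E}^{\le 1}_{meas}\to\mathbb{E}^{\le 1}_{meas}$ is defined by the same rules, except $\mathsf{wlp}[\mathtt{diverge}](f)=1$ and for loops one takes the greatest fixed point of $Y\mapsto[\neg\varphi]\cdot f+[\varphi]\cdot\mathsf{wlp}[B](Y)$. $\mathsf{cwp}[C](f)(\sigma)=\mathsf{wp}[C](f)(\sigma)/\mathsf{wlp}[C](1)(\sigma)$ if $\mathsf{wlp}[C](1)(\sigma)\neq0$, and is undefined otherwise. Riemann transformers. For an integer $N\ge1$, $\overline{\mathsf{wp}}^N[C]:\mathbb{E}\to\mathbb{E}$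 is defined by the same rules as $\mathsf{wp}$ (on all of $\mathbb{E}$, fixed points taken in the complete lattice $\mathbb{E}$), except $\overline{\mathsf{wp}}^N[x:\approx\mathtt{unif}_{[0,1]}](f)=\frac1N\sum_{i=0}^{N-1}\sup_{\xi\in[i/N,(i+1)/N]}f[x/\xi]$ (pointwise sup). $\underline{\mathsf{wlp}}^N[C]:\mathbb{E}^{\le1}\to\mathbb{E}^{\le1}$ is defined by the same rules as $\mathsf{wlp}$ (on all of $\mathbb{E}^{\le 1}$), except $\underline{\mathsf{wlp}}^N[x:\approx\mathtt{unif}_{[0,1]}](f)=\frac1N\sum_{i=0}^{N-1}\inf_{\xi\in[i/N,(i+1)/N]}f[x/\xi]$. Invariants. For $C=\mathtt{while}(\varphi)\{B\}$: $I\in\mathbb{E}$ is a $\overline{\mathsf{wp}}^N$-superinvariant of $C$ w.r.t. $f\in\mathbb{E}$ if $[\varphi]\cdot\overline{\mathsf{wp}}^N[B](I)+[\neg\varphi]\cdot f\sqsubseteq I$; $I\in\mathbb{E}^{\le1}$ is a $\underline{\mathsf{wlp}}^N$-subinvariant of $C$ w.r.t. $f\in\mathbb{E}^{\le1}$ if $I\sqsubseteq[\varphi]\cdot\underline{\mathsf{wlp}}^N[B](I)+[\neg\varphi]\cdot f$. *)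

(* Defs.v *)
From HB Require Import structures.
From mathcomp Require Import all_boot all_order all_algebra.
From mathcomp Require Import all_classical all_reals all_analysis.
From mathcomp Require Import measurable_realfun.

Set Implicit Arguments.
Unset Strict Implicit.
Unset Printing Implicit Defensive.

Import Order.TTheory GRing.Theory Num.Theory.
Import numFieldNormedType.Exports.

Local Open Scope classical_set_scope.
Local Open Scope ring_scope.

Definition state (R : realType) (V : finType) : Type := V -> {nonneg R}.

(* The open sets of [0, +oo)^V, as the subspace topology of R^V. *)
Definition state_open (R : realType) (V : finType) : set (set (state R V)) :=
  [set U | exists2 O : set {ptws V -> R},
     open O & U = [set s | O (fun v => (s v)%:num)]].

HB.instance Definition _ (R : realType) (V : finType) :=
  Choice.copy (state R V) (V -> {nonneg R}).
HB.instance Definition _ (R : realType) (V : finType) :=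
  isPointed.Build (state R V) (fun=> 0%:nng).

HB.instance Definition _ (R : realType) (V : finType) :=
  @isMeasurable.Build (sigma_display (@state_open R V)) (state R V)
    <<s @state_open R V >> (@sigma_algebra0 _ setT (@state_open R V))
    (@sigma_algebraC _ (@state_open R V))
    (@sigma_algebra_bigcup _ setT (@state_open R V)).

Definition update (R : realType) (V : finType)
    (s : state R V) (x : V) (xi : {nonneg R}) : state R V :=
  fun y => if y == x then xi else s y.

(* Identity on [0, +oo); only used there. *)
Definition to_nonneg (R : realType) (xi : R) : {nonneg R} := `|xi|%:nng.

Record arith_expr (R : realType) (V : finType) := ArithExpr {
  eval_expr :> state R V -> {nonneg R};
  measurable_expr : measurable_fun setT (fun s => (eval_expr s)%:num) }.

Record rat_prob := RatProb {
  prob_rat :> rat;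
  prob_rat01 : 0 <= prob_rat <= 1 }.

Inductive prog (R : realType) (V : finType) : Type :=
| Skip
| Diverge
| Assign of V & arith_expr R V
| Observe of {mfun state R V >-> bool}
| Unif of V
| If of {mfun state R V >-> bool} & prog R V & prog R V
| PChoice of prog R V & rat_prob & prog R V
| Seq of prog R V & prog R V
| While of {mfun state R V >-> bool} & prog R V.
Arguments Skip {R V}.
Arguments Diverge {R V}.
Arguments Unif {R V} x.

Local Open Scope ereal_scope.

Section expectations.
Context {R : realType} {V : finType}.
Local Notation S := (state R V).
Local Notation fct := (S -> \bar R).

Definition expectations : set fct := [set f | forall s, 0 <= f s].
Definition expectations1 : set fct := [set f | forall s, 0 <= f s <= 1].
Definition expectations_meas : set fct :=
  [set f | expectations f /\ measurable_fun setT f].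
Definition expectations1_meas : set fct :=
  [set f | expectations1 f /\ measurable_fun setT f].

Definition exp_le (f g : fct) : Prop := forall s, f s <= g s.

Definition iverson (b : bool) : \bar R := (b%:R)%:E.

Definition is_lfp (D : set fct) (Phi : fct -> fct) (X : fct) : Prop :=
  [/\ D X, Phi X = X & forall Y, D Y -> Phi Y = Y -> exp_le X Y].
Definition is_gfp (D : set fct) (Phi : fct -> fct) (X : fct) : Prop :=
  [/\ D X, Phi X = X & forall Y, D Y -> Phi Y = Y -> exp_le Y X].

(* The least (greatest) fixed point of Phi among the elements of D; the default
   value is only taken when there is none. *)
Definition lfp (D : set fct) (Phi : fct -> fct) : fct :=
  xget (cst 0) [set X | is_lfp D Phi X].
Definition gfp (D : set fct) (Phi : fct -> fct) : fct :=
  xget (cst 0) [set X | is_gfp D Phi X].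

(* The rules shared by all transformers, which only differ in the value of
   diverge, in the uniform assignment and in the fixed point used for loops. *)
Fixpoint transformer (d : \bar R) (unif : V -> fct -> fct)
    (fixp : (fct -> fct) -> fct) (C : prog R V) (f : fct) : fct :=
  let T := transformer d unif fixp in
  match C with
  | Skip => f
  | Diverge => cst d
  | Assign x E => fun s => f (update s x (E s))
  | Observe phi => fun s => iverson (phi s) * f s
  | Unif x => unif x f
  | If phi C1 C2 => fun s =>
      iverson (phi s) * T C1 f s + iverson (~~ phi s) * T C2 f s
  | PChoice C1 p C2 => fun s =>
      (ratr p)%:E * T C1 f s + (1 - ratr p)%:E * T C2 f s
  | Seq C1 C2 => T C1 (T C2 f)
  | While phi B =>
      fixp (fun Y s => iverson (~~ phi s) * f s + iverson (phi s) * T B Y s)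
  end.

Definition unif_int (x : V) (f : fct) : fct :=
  fun s => \int[@lebesgue_measure R]_(xi in `[0%R, 1%R])
             f (update s x (to_nonneg xi)).

Definition subinterval (N i : nat) : set {nonneg R} :=
  [set xi | (i%:R / N%:R <= xi%:num <= i.+1%:R / N%:R)%R].

Definition unif_upper (N : nat) (x : V) (f : fct) : fct :=
  fun s => (N%:R^-1)%:E *
    \sum_(i < N) ereal_sup [set f (update s x xi) | xi in subinterval N i].

Definition unif_lower (N : nat) (x : V) (f : fct) : fct :=
  fun s => (N%:R^-1)%:E *
    \sum_(i < N) ereal_inf [set f (update s x xi) | xi in subinterval N i].

(* wp and wlp are meant for arguments in expectations_meas and
   expectations1_meas, respectively. *)
Definition wp : prog R V -> fct -> fct :=
  transformer 0 unif_int (lfp expectations_meas).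
Definition wlp : prog R V -> fct -> fct :=
  transformer 1 unif_int (gfp expectations1_meas).

Definition wp_upper (N : nat) : prog R V -> fct -> fct :=
  transformer 0 (unif_upper N) (lfp expectations).
Definition wlp_lower (N : nat) : prog R V -> fct -> fct :=
  transformer 1 (unif_lower N) (gfp expectations1).

(* None stands for undefined. *)
Definition cwp (C : prog R V) (f : fct) (s : S) : option (\bar R) :=
  if wlp C (cst 1) s != 0 then Some (wp C f s / wlp C (cst 1) s) else None.

Definition superinvariant (N : nat) (phi : {mfun S >-> bool}) (B : prog R V)
    (f I : fct) : Prop :=
  exp_le
    (fun s => iverson (phi s) * wp_upper N B I s + iverson (~~ phi s) * f s) I.
Definition subinvariant (N : nat) (phi : {mfun S >-> bool}) (B : prog R V)
    (f I : fct) : Prop :=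
  exp_le I
    (fun s => iverson (phi s) * wlp_lower N B I s + iverson (~~ phi s) * f s).

End expectations.

(* Main.v *)
(* The rules for wp and wlp are mirror images: wp lives in [0, +oo], uses least
   fixed points and starts from diverge = 0; wlp lives in [0, 1], uses greatest
   fixed points and starts from diverge = 1. A boolean b selects wp (true) or wlp
   (false), and everything is done once for the order "dle b", for which every
   fixed point is a least one.

   On measurable expectations the exact transformer commutes with limits of
   dle-monotone sequences (monotone convergence, resp. dominated convergence, for
   the uniform assignment), so the fixed point of a loop is the limit of the
   Kleene iterates. The Riemann transformer is merely monotone, with fixed points
   given by Knaster-Tarski on a complete lattice of arbitrary functions. It
   dominates the exact transformer on measurable arguments, by induction on the
   program. Given an invariant I, possibly not measurable, each Kleene iterate of
   the exact loop is below I: if Z <= I with Z measurable, then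
   exact(Z) <= riemann(Z) <= riemann(I), so the next iterate is also below I. *)
Require Import Defs.
From HB Require Import structures.
From mathcomp Require Import all_boot all_order all_algebra.
From mathcomp Require Import all_classical all_reals all_analysis.
From mathcomp Require Import measurable_realfun.
Import Order.TTheory GRing.Theory Num.Theory.
Import numFieldNormedType.Exports.

Local Open Scope classical_set_scope.
Local Open Scope ereal_scope.

Set Implicit Arguments.
Unset Strict Implicit.
Unset Printing Implicit Defensive.

(** * Extended reals ordered in a direction chosen by a boolean *)

Section directed_order.
Context {R : realType}.
Implicit Types (b : bool) (x y z : \bar R).

Definition dle b x y := if b then x <= y else y <= x.
Definition dbot b : \bar R := if b then 0 else 1.
Definition dtop b : \bar R := if b then +oo else 0.
Definition drange b x := (0 <= x) && (b || (x <= 1)).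
(** Greatest lower bound for [dle b]. Since negating [b] reverses the order, [dinf (~~ b)] is the
    least upper bound for [dle b]; suprema are always written this way below. *)
Definition dinf b (A : set (\bar R)) := if b then ereal_inf A else ereal_sup A.

Lemma dleN b x y : dle (~~ b) x y = dle b y x.
Proof. by case: b. Qed.

Lemma dle_refl b x : dle b x x.
Proof. by case: b => /=. Qed.

Lemma dle_trans b y x z : dle b x y -> dle b y z -> dle b x z.
Proof. by case: b => /= xy yz; [exact: le_trans yz | exact: le_trans xy]. Qed.

Lemma dle_anti b x y : dle b x y -> dle b y x -> x = y.
Proof. by case: b => /= xy yx; apply/le_anti; rewrite xy yx. Qed.

Lemma dbot_range b : drange b (dbot b).
Proof. by case: b; rewrite /drange /=; rewrite ?lexx ?lee01. Qed.

Lemma dbot_le b x : drange b x -> dle b (dbot b) x.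
Proof. by rewrite /drange; case: b => /andP[]. Qed.

Lemma dtop_range b : drange b (dtop b).
Proof. by case: b; rewrite /drange /= ?leey ?lexx ?lee01. Qed.

Lemma le_dtop b x : drange b x -> dle b x (dtop b).
Proof. by rewrite /drange; case: b => /andP[]//=; rewrite leey. Qed.

Lemma drange_ge0 b x : drange b x -> 0 <= x.
Proof. by case/andP. Qed.

Lemma drange0 b : drange b 0.
Proof. by rewrite /drange lexx lee01 orbT. Qed.

Lemma dinf_lb b (A : set (\bar R)) x : A x -> dle b (dinf b A) x.
Proof. by case: b => Ax /=; [exact: ereal_inf_lbound|exact: ereal_sup_ubound]. Qed.

Lemma dinf_glb b (A : set (\bar R)) x :
  (forall y, A y -> dle b x y) -> dle b x (dinf b A).
Proof.
case: b => /= h; first exact: le_ereal_inf_tmp.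
exact: ge_ereal_sup.
Qed.

Lemma dinf_range b (A : set (\bar R)) :
  A !=set0 -> (forall y, A y -> drange b y) -> drange b (dinf b A).
Proof.
move=> [a Aa] rA; have := rA _ Aa; case: b rA => /= rA ra.
  by rewrite /drange andbT; apply: le_ereal_inf_tmp => y /rA/drange_ge0.
rewrite /drange /=; apply/andP; split.
  exact: le_trans (drange_ge0 ra) (ereal_sup_ubound Aa).
by apply: ge_ereal_sup => y /rA/andP[].
Qed.

Lemma dsup_range b (A : set (\bar R)) :
  A !=set0 -> (forall y, A y -> drange b y) -> drange b (dinf (~~ b) A).
Proof.
move=> [a Aa] rA; have := rA _ Aa; case: b rA => /= rA ra.
  rewrite /drange andbT (le_trans (drange_ge0 ra)) //.
  exact: ereal_sup_ubound.
rewrite /drange /=; apply/andP; split.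
  by apply: le_ereal_inf_tmp => y /rA/drange_ge0.
apply: le_trans (ereal_inf_lbound Aa) _; by case/andP: ra.
Qed.

Lemma dle_lim b (u v : (\bar R)^nat) x y : u @ \oo --> x -> v @ \oo --> y ->
  (forall n, dle b (u n) (v n)) -> dle b x y.
Proof.
move=> ux vy uv.
have cu : cvgn u by apply/cvg_ex; exists x.
have cv : cvgn v by apply/cvg_ex; exists y.
rewrite -(cvg_lim _ ux)// -(cvg_lim _ vy)//.
by case: b uv => /= uv; apply: lee_lim => //; apply: nearW.
Qed.

Lemma drange_lim b (u : (\bar R)^nat) x : u @ \oo --> x ->
  (forall n, drange b (u n)) -> drange b x.
Proof.
move=> ux ru; apply/andP; split.
  apply: (@dle_lim true (cst 0) u 0 x (cvg_cst _) ux) => n.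
  exact: drange_ge0 (ru n).
case: b ru => //= ru; apply: (@dle_lim true u (cst 1) x 1 ux (cvg_cst _)) => n.
by case/andP: (ru n).
Qed.

Lemma dle_homo b (u : (\bar R)^nat) : (forall n, dle b (u n) (u n.+1)) ->
  forall m n, (m <= n)%N -> dle b (u m) (u n).
Proof.
move=> uS m n /subnK <-; elim: (n - m)%N => [|k ih]; first exact: dle_refl.
exact: dle_trans ih (uS _).
Qed.

Lemma dle_is_cvg b (u : (\bar R)^nat) :
  (forall n, dle b (u n) (u n.+1)) -> cvgn u.
Proof.
move=> uS; have h := dle_homo uS; case: b uS h => _ /= h.
  exact: ereal_nondecreasing_is_cvgn.
exact: ereal_nonincreasing_is_cvgn.
Qed.

Lemma dle_limn b (u : (\bar R)^nat) n : (forall n, dle b (u n) (u n.+1)) ->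
  dle b (u n) (limn u).
Proof.
move=> uS; have cu := dle_is_cvg uS.
apply: (@dle_lim b (fun=> u n) (fun k => u (k + n)%N)); first exact: cvg_cst.
  by move: cu; rewrite -(cvg_shiftn n).
by move=> k; apply: dle_homo => //; exact: leq_addl.
Qed.

Lemma dle_convex b (p : R) x y x' y' : (0 <= p <= 1)%R ->
  dle b x x' -> dle b y y' ->
  dle b (p%:E * x + (1 - p)%:E * y) (p%:E * x' + (1 - p)%:E * y').
Proof.
move=> /andP[p0 p1] hx hy; have q0 : (0 <= 1 - p)%R by rewrite subr_ge0.
by case: b hx hy => /= hx hy; apply: leeD; apply: lee_wpmul2l; rewrite ?lee_fin.
Qed.

Lemma iverson_if c x y : iverson c * x + iverson (~~ c) * y = if c then x else y.
Proof. by case: c; rewrite /iverson /= mul1e mul0e ?adde0 ?add0e. Qed.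

Lemma iverson_ifN c x y : iverson (~~ c) * x + iverson c * y = if c then y else x.
Proof. by case: c; rewrite /iverson /= mul1e mul0e ?adde0 ?add0e. Qed.

Lemma iverson_mul c x : iverson c * x = if c then x else 0.
Proof. by case: c; rewrite /iverson /= ?mul1e ?mul0e. Qed.

Lemma drange_convex b (p : R) x y : (0 <= p <= 1)%R -> drange b x -> drange b y ->
  drange b (p%:E * x + (1 - p)%:E * y).
Proof.
move=> /andP[p0 p1] /andP[x0 x1] /andP[y0 y1].
have q0 : (0 <= 1 - p)%R by rewrite subr_ge0.
rewrite /drange adde_ge0 ?mule_ge0 ?lee_fin //=; case: b x1 y1 => //= x1 y1.
have -> : 1 = p%:E * 1 + (1 - p)%:E * 1 :> \bar R.
  by rewrite !mule1 -EFinD addrC subrK.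
by apply: leeD; apply: lee_wpmul2l; rewrite ?lee_fin.
Qed.

End directed_order.

(** * Borel measurability of maps into and out of the state space *)

Section measurable_states.
Local Open Scope ring_scope.
Context {R : realType} {V : finType}.
Local Notation S := (state R V).

(** It is enough that the filter generated by the sup-norm boxes around [p] converges to [p]: an
    open set containing [p] then contains one of these boxes. *)
Lemma open_ptws_box (W : set {ptws V -> R}) (p : {ptws V -> R}) : open W -> W p ->
  exists2 e : R, (0 < e)%R &
    forall q : V -> R, (forall v, `|q v - p v| < e)%R -> W q.
Proof.
move=> oW Wp.
pose F := filter_from [set e : R | (0 < e)%R]
  (fun e => [set q : {ptws V -> R} | forall v, (`|q v - p v| < e)%R]).
have FF : Filter F.
  apply: filter_from_filter; first by exists 1%R => /=.
  move=> e1 e2 /= e10 e20; exists (Num.min e1 e2); first by rewrite /= lt_min e10.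
  move=> q /= h; split => v; have := h v; rewrite lt_min => /andP[] //.
have Fp : F --> p.
  (* The pointwise topology is the supremum of the topologies induced by the coordinates, so
     convergence is tested one coordinate at a time. *)
  apply/cvg_sup => v U [W' [[A oA <-] Ap AU]].
  have /nbhs_ballP[e /= e0 eA] := open_nbhs_nbhs (conj oA Ap).
  exists e => //= q hq; apply: AU; apply: eA; rewrite /ball /= distrC.
  exact: hq.
have /Fp[e /= e0 eW] := open_nbhs_nbhs (conj oW Wp).
by exists e.
Qed.

(** Open sets generate the sigma-algebra, and an open set is the union of the countably many
    rational boxes that it contains. The preimage of a box is a finite intersection of coordinate
    preimages. *)
Lemma measurable_fun_state d (T : measurableType d) (g : T -> S) :
  (forall v, measurable_fun setT (fun t => (g t v)%:num)) -> measurable_fun setT g.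
Proof.
move=> mg; apply: (measurability (@state_open R V)) => //.
move=> _ [_ [W oW ->] <-]; rewrite setTI.
pose box (q : {ffun V -> rat * rat}) : set (V -> R) :=
  [set r | forall v, (ratr (q v).1 < r v < ratr (q v).2)%R].
(* Boxes not contained in [W] contribute the empty set, so that the union runs over the whole
   countable type of rational boxes. *)
pose A q := if `[< box q `<=` W >] then
  \bigcap_(v in [set: V]) ((fun t => (g t v)%:num) @^-1`
    `]ratr (q v).1, ratr (q v).2[%classic) else set0.
rewrite (_ : _ @^-1` _ = \bigcup_q A q).
  apply: countable_bigcupT_measurable => // q; rewrite /A; case: ifP => _ //.
  apply: fin_bigcap_measurable; first exact: finite_finset.
  by move=> v _; rewrite -[X in measurable X]setTI; apply: mg.
apply/seteqP; split => t /=; last first.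
  by move=> [q _]; rewrite /A; case: asboolP => // qW ht; apply: qW => v;
    have := ht v I; rewrite /= in_itv.
(* Rational endpoints are chosen on both sides of each coordinate of [g t], at distance less than
   [e]: the box contains [g t] and stays inside [W]. *)
move=> Wt; have [e e0 eW] := open_ptws_box oW Wt.
have /choice[q hq] : forall v, exists q : rat * rat,
    ((g t v)%:num - e < ratr q.1 < (g t v)%:num)%R /\
    ((g t v)%:num < ratr q.2 < (g t v)%:num + e)%R.
  move=> v.
  have /rat_in_itvoo[q1] : ((g t v)%:num - e < (g t v)%:num)%R.
    by rewrite ltrBlDr ltrDl.
  have /rat_in_itvoo[q2] : ((g t v)%:num < (g t v)%:num + e)%R by rewrite ltrDl.
  by rewrite !in_itv /= => h2 h1; exists (q1, q2).
exists (finfun q) => //; rewrite /A; case: asboolP => [_ v _|].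
  by rewrite /= in_itv /= ffunE; have [/andP[_ ->] /andP[->]] := hq v.
case=> r hr; apply: eW => v; have := hr v; rewrite ffunE => /andP[h1 h2].
have [/andP[h3 _] /andP[_ h4]] := hq v.
by rewrite ltr_distl (lt_trans h3 h1) (lt_trans h2 h4).
Qed.

Lemma measurable_state_coord (v : V) : measurable_fun setT (fun s : S => (s v)%:num).
Proof.
apply: (measurability _ (RGenOpens.measurableE R)) => _ [_ [x [y ->]] <-].
rewrite setTI; apply: sub_sigma_algebra.
exists [set q : {ptws V -> R} | `]x, y[%classic (q v)] => //.
apply: (@open_comp _ _ (fun q : {ptws V -> R} => q v)); last exact: interval_open.
by move=> q _; exact: (@proj_continuous V (fun=> R)).
Qed.

Lemma measurable_update d (T : measurableType d) (g : T -> S) (x : V)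
    (h : T -> {nonneg R}) :
  measurable_fun setT g -> measurable_fun setT (fun t => (h t)%:num) ->
  measurable_fun setT (fun t => update (g t) x (h t)).
Proof.
move=> mg mh; apply: measurable_fun_state => v; rewrite /update.
case: (v == x); first exact: mh.
exact: (measurableT_comp (measurable_state_coord v) mg).
Qed.

Lemma measurable_update_to_nonneg d (T : measurableType d) (g : T -> S) (x : V)
    (h : T -> R) : measurable_fun setT g -> measurable_fun setT h ->
  measurable_fun setT (fun t => update (g t) x (to_nonneg (h t))).
Proof.
move=> mg mh; apply: measurable_update => //.
exact: (measurableT_comp (@normr_measurable R setT) mh).
Qed.

End measurable_states.

(** * Fixed points of expectation transformers: Kleene iteration and Knaster-Tarski *)

Section expectation_order.
Context {R : realType} {V : finType}.
Local Notation S := (state R V).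
Local Notation fct := (S -> \bar R).
Implicit Types (b : bool) (f g X Y Z : fct) (u : nat -> fct).

Definition Dom b : set fct := if b then expectations else expectations1.
Definition DomM b : set fct :=
  if b then expectations_meas else expectations1_meas.
Definition fle b f g := forall s, dle b (f s) (g s).
Definition is_fix b := if b then @is_lfp R V else @is_gfp R V.
Definition fixp b := if b then @lfp R V else @gfp R V.

Lemma DomE b f : Dom b f <-> forall s, drange b (f s).
Proof.
case: b; rewrite /Dom /drange /=; last by [].
by split=> h s; move: (h s); rewrite andbT.
Qed.

Lemma DomME b f : DomM b f <-> Dom b f /\ measurable_fun setT f.
Proof. by case: b. Qed.

Lemma DomM_Dom b f : DomM b f -> Dom b f.
Proof. by move=> /DomME[]. Qed.

Lemma is_fixE b D Phi X : is_fix b D Phi X <->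
  [/\ D X, Phi X = X & forall Y, D Y -> Phi Y = Y -> fle b X Y].
Proof. by case: b. Qed.

Lemma fle_trans b g f h : fle b f g -> fle b g h -> fle b f h.
Proof. by move=> fg gh s; exact: dle_trans (fg s) (gh s). Qed.

Lemma fle_anti b f g : fle b f g -> fle b g f -> f = g.
Proof. by move=> fg gf; apply/funext => s; exact: dle_anti (fg s) (gf s). Qed.

(** The choice operator behind [lfp] and [gfp] takes its default only if no such fixed point exists;
    given one, antisymmetry makes it unique. *)
Lemma fixpE b D Phi X : is_fix b D Phi X -> fixp b D Phi = X.
Proof.
move=> hX; have : is_fix b D Phi (fixp b D Phi).
  by case: b hX => hX; exact: xgetI hX.
move: hX => /is_fixE[DX PX minX] /is_fixE[DY PY minY].
by apply: (@fle_anti b); [exact: minY|exact: minX].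
Qed.

Lemma DomM_bot b : DomM b (cst (dbot b)).
Proof.
apply/DomME; split; last exact: measurable_cst.
by apply/DomE => s; exact: dbot_range.
Qed.

Lemma DomM_lim b u f : (forall n, DomM b (u n)) ->
  (forall s, u n s @[n --> \oo] --> f s) -> DomM b f.
Proof.
move=> Du uf; apply/DomME; split.
  apply/DomE => s; apply: drange_lim (uf s) _ => n.
  by move: s; apply/DomE/DomM_Dom.
apply: (emeasurable_fun_cvg u) => [n|s _]; last exact: uf.
by have /DomME[] := Du n.
Qed.

(** Scott continuity along countable chains, restricted to measurable arguments, where the
    convergence theorems for the integral apply. *)
Record omega_continuous b (T : fct -> fct) : Prop := OmegaContinuous {
  omega_continuous_map : forall f, DomM b f -> DomM b (T f);
  omega_continuous_mono : forall f g, DomM b f -> DomM b g -> fle b f g ->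
    fle b (T f) (T g);
  omega_continuous_cvg : forall u f, (forall n, DomM b (u n)) ->
    (forall n, fle b (u n) (u n.+1)) ->
    (forall s, u n s @[n --> \oo] --> f s) ->
    forall s, T (u n) s @[n --> \oo] --> T f s }.

(* Y ranges over non-measurable expectations too: this is how the fixed points
   of the Riemann transformers and the invariants enter. *)
Lemma kleene b Phi : omega_continuous b Phi -> exists2 X, is_fix b (DomM b) Phi X &
  forall Y, Dom b Y -> (forall Z, DomM b Z -> fle b Z Y -> fle b (Phi Z) Y) ->
    fle b X Y.
Proof.
move=> [mapP monoP cvgP].
pose u n : fct := iter n Phi (cst (dbot b)).
have Du n : DomM b (u n).
  by elim: n => [|n ih]; [exact: DomM_bot|exact: mapP].
have iu n : fle b (u n) (u n.+1).
  elim: n => [|n ih]; last exact: (monoP (u n) (u n.+1) (Du _) (Du _)).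
  
  by move=> s; apply: dbot_le; move: s; apply/DomE/DomM_Dom/Du.
pose X s := limn (fun n => u n s).
have uX s : u n s @[n --> \oo] --> X s.
  by apply: (@dle_is_cvg _ b (fun n => u n s)) => n; exact: iu.
have DX : DomM b X := DomM_lim Du uX.
have ind Y : Dom b Y -> (forall Z, DomM b Z -> fle b Z Y -> fle b (Phi Z) Y) ->
    fle b X Y.
  move=> DY hY s; apply: (dle_lim (uX s) (cvg_cst _)) => n; move: s.
  elim: n => [s|n ih]; last exact: hY.
  by apply: dbot_le; move: s; apply/DomE.
(* The sequence [Phi (u n)] tends to [Phi X] by continuity, and to [X] because it is [u] shifted by
   one. *)
have PX : Phi X = X.
  apply/funext => s; have /cvg_lim h := cvgP _ _ Du iu uX s.
  by rewrite -h//; apply: cvg_lim => //; have := uX s;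
    rewrite -(cvg_shiftS (fun n => u n s)).
exists X => //; apply/is_fixE; split => // Y DY PY.
apply: ind; first exact: DomM_Dom.
by move=> Z DZ ZY; rewrite -PY; exact: monoP.
Qed.

Lemma omega_continuous_fixE b Phi : omega_continuous b Phi ->
  is_fix b (DomM b) Phi (fixp b (DomM b) Phi).
Proof. by move=> /kleene[X fX _]; rewrite (fixpE fX). Qed.

(** Fixed point induction for a bound [Y] that may fail to be measurable: [Phi] is never applied to
    [Y], only to measurable [Z] below it. *)
Lemma omega_continuous_fix_ind b Phi Y : omega_continuous b Phi -> Dom b Y ->
  (forall Z, DomM b Z -> fle b Z Y -> fle b (Phi Z) Y) ->
  fle b (fixp b (DomM b) Phi) Y.
Proof. by move=> /kleene[X fX ind] DY hY; rewrite (fixpE fX); exact: ind. Qed.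

Record monotone b (T : fct -> fct) : Prop := Monotone {
  monotone_map : forall f, Dom b f -> Dom b (T f);
  monotone_le : forall f g, Dom b f -> Dom b g -> fle b f g ->
    fle b (T f) (T g) }.

(** The fixed point is the pointwise infimum of all prefixed points. The top element is one of them,
    so the infimum is over a nonempty set and stays in range. *)
Lemma knaster_tarski b Psi : monotone b Psi -> exists2 X, is_fix b (Dom b) Psi X &
  forall Y, Dom b Y -> fle b (Psi Y) Y -> fle b X Y.
Proof.
move=> [mapP monoP].
pose P : set fct := [set Y | Dom b Y /\ fle b (Psi Y) Y].
pose X s := dinf b [set Y s | Y in P].
have PT : P (cst (dtop b)).
  have DT : Dom b (cst (dtop b)) by apply/DomE => s; exact: dtop_range.
  by split => // s; apply: le_dtop; move: s; apply/DomE/mapP.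
have DX : Dom b X.
  apply/DomE => s; apply: dinf_range; first by exists (dtop b), (cst (dtop b)).
  by move=> _ [Y [DY _] <-]; move: s; apply/DomE.
have Xlb Y : P Y -> fle b X Y by move=> PY s; apply: dinf_lb; exists Y.
have PXX : fle b (Psi X) X.
  move=> s; apply: dinf_glb => _ [Y [DY PY] <-].
  by apply: dle_trans (PY s); apply: monoP => //; exact: Xlb.
have XPX : fle b X (Psi X).
  by apply: Xlb; split; [exact: mapP|apply: monoP => //; exact: mapP].
exists X => [|Y DY PY]; last exact: Xlb.
apply/is_fixE; split => //; first exact: fle_anti PXX XPX.
by move=> Y DY PY; apply: Xlb; split => //; rewrite PY => s; exact: dle_refl.
Qed.

End expectation_order.

(** * Closure of omega-continuous transformers under the program constructs *)

Section omega_continuous_closure.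
Context {R : realType} {V : finType}.
Local Notation S := (state R V).
Local Notation fct := (S -> \bar R).
Variable b : bool.
Implicit Types (f g X Y Z : fct) (u : nat -> fct) (T : fct -> fct).
Implicit Types (phi : {mfun S >-> bool}).

Lemma omega_continuous_id : omega_continuous b (@id fct).
Proof. by split. Qed.

Lemma omega_continuous_cst f : DomM b f -> omega_continuous b (fun=> f).
Proof.
by move=> Df; split=> // [g h _ _ _ s|u g _ _ _ s]; [exact: dle_refl|exact: cvg_cst].
Qed.

Lemma omega_continuous_comp T1 T2 :
  omega_continuous b T1 -> omega_continuous b T2 ->
  omega_continuous b (T1 \o T2).
Proof.
move=> [m1 l1 c1] [m2 l2 c2]; split => /= [f Df|f g Df Dg fg|u f Du iu uf s].
- exact/m1/m2.
- by apply: l1; [exact: m2|exact: m2|exact: l2].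
- apply: (c1 (T2 \o u)) => [n|n|{}s] /=; first exact: m2.
  + by apply: l2.
  + exact: c2.
Qed.

Lemma omega_continuous_subst (h : S -> S) : measurable_fun setT h ->
  omega_continuous b (fun f s => f (h s)).
Proof.
move=> mh; split => [f /DomME[/DomE Df mf]|f g _ _ fg s|u f _ _ uf s].
- apply/DomME; split; first by apply/DomE => s.
  exact: (measurableT_comp mf mh).
- exact: fg.
- exact: uf.
Qed.

Lemma omega_continuous_if phi T1 T2 :
  omega_continuous b T1 -> omega_continuous b T2 ->
  omega_continuous b (fun f s => if phi s then T1 f s else T2 f s).
Proof.
move=> [m1 l1 c1] [m2 l2 c2]; split => [f Df|f g Df Dg fg s|u f Du iu uf s].
- have /DomME[/DomE D1 mf1] := m1 f Df; have /DomME[/DomE D2 mf2] := m2 f Df.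
  apply/DomME; split; first by apply/DomE => s; case: ifP.
  by apply: measurable_fun_ifT.
- by case: ifP => _; [exact: l1|exact: l2].
- by case: ifP => _; [exact: c1|exact: c2].
Qed.

Lemma omega_continuous_convex (p : R) T1 T2 : (0 <= p <= 1)%R ->
  omega_continuous b T1 -> omega_continuous b T2 ->
  omega_continuous b (fun f s => p%:E * T1 f s + (1 - p)%:E * T2 f s).
Proof.
move=> p01 [m1 l1 c1] [m2 l2 c2]; split => [f Df|f g Df Dg fg s|u f Du iu uf s].
- have /DomME[/DomE D1 mf1] := m1 f Df; have /DomME[/DomE D2 mf2] := m2 f Df.
  apply/DomME; split; first by apply/DomE => s; exact: drange_convex.
  by apply: emeasurable_funD; apply: emeasurable_funM => //; exact: measurable_cst.
- by apply: dle_convex; [exact: p01|exact: l1|exact: l2].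
- have Df := DomM_lim Du uf.
  have /DomM_Dom/DomE D1 := m1 f Df; have /DomM_Dom/DomE D2 := m2 f Df.
  have /andP[p0 p1] := p01.
  apply: cvgeD.
  + apply: ge0_adde_def; rewrite inE mule_ge0 ?(drange_ge0 (D1 _))
      ?(drange_ge0 (D2 _))//.
    by rewrite lee_fin subr_ge0.
  + by apply: cvgeZl => //; exact: c1.
  + by apply: cvgeZl => //; exact: c2.
Qed.

(** Write [F f] for the fixed point with postexpectation [f]. For a chain [u] with limit [f], the
    limit [X] of [F (u n)] is a fixed point for [f], hence above [F f] by minimality. Conversely
    each [F (u n)] is below [F f] by monotonicity. *)
Lemma omega_continuous_loop phi T : omega_continuous b T ->
  omega_continuous b (fun f =>
    fixp b (DomM b) (fun Y s => if phi s then T Y s else f s)).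
Proof.
move=> gT; pose Phi f Y s := if phi s then T Y s else f s.
have gPhi f : DomM b f -> omega_continuous b (Phi f).
  by move=> Df; apply: omega_continuous_if => //; exact: omega_continuous_cst.
have fixP f (Df : DomM b f) := (is_fixE _ _ _ _).1 (omega_continuous_fixE (gPhi f Df)).
rewrite -/(Phi _); set F := fun f => _.
have mF f : DomM b f -> DomM b (F f) by move=> /fixP[].
have leF f g : DomM b f -> DomM b g -> fle b f g -> fle b (F f) (F g).
  move=> Df Dg fg; have [DG PG _] := fixP g Dg.
  apply: omega_continuous_fix_ind => [| |Z DZ ZG]; [exact: gPhi|exact: DomM_Dom|].
  rewrite -[X in fle b _ X]PG /Phi => s; case: ifP => _; last exact: fg.
  by apply: (omega_continuous_mono gT).
split => // u f Du iu uf s.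
have Df := DomM_lim Du uf.
have [DF PF minF] := fixP f Df.
have iF n : fle b (F (u n)) (F (u n.+1)) by apply: leF.
pose X t := limn (fun n => F (u n) t).
have uX t : F (u n) t @[n --> \oo] --> X t.
  by apply: (@dle_is_cvg _ b (fun n => F (u n) t)) => n; exact: iF.
have DX : DomM b X by apply: (DomM_lim _ uX) => n; exact: mF.
suff -> : F f = X by exact: uX.
apply: (@fle_anti _ _ b).
  apply: minF => //; apply/funext => t; apply/esym.
  rewrite -(cvg_lim _ (uX t))//; apply: cvg_lim => //.
  (* Each [F (u n)] is unfolded once: where the guard holds, the limit is passed through [T] by its
     continuity, and elsewhere it is the limit of [u]. *)
  rewrite (_ : (fun n => F (u n) t) = (fun n => Phi (u n) (F (u n)) t)); last first.
    by apply/funext => n; have [_ -> _] := fixP _ (Du n).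
  rewrite /Phi; case: ifP => _; last exact: uf.
  by apply: (omega_continuous_cvg gT (u := fun n => F (u n))) => // n; exact: mF.
move=> t; apply: (dle_lim (uX t) (cvg_cst _)) => n; move: t; apply: leF => // t.
rewrite -(cvg_lim _ (uf t))//; apply: (@dle_limn _ b (fun n => u n t)) => k.
exact: iu.
Qed.

End omega_continuous_closure.

(** * Closure of monotone transformers under the program constructs *)

Section monotone_closure.
Context {R : realType} {V : finType}.
Local Notation S := (state R V).
Local Notation fct := (S -> \bar R).
Variable b : bool.
Implicit Types (f g : fct) (T : fct -> fct) (phi : S -> bool).

Lemma monotone_cst f : Dom b f -> monotone b (fun=> f).
Proof. by move=> Df; split=> // g h _ _ _ s; exact: dle_refl. Qed.

Lemma monotone_comp T1 T2 : monotone b T1 -> monotone b T2 ->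
  monotone b (T1 \o T2).
Proof.
move=> [m1 l1] [m2 l2]; split => /= [f Df|f g Df Dg fg]; first exact/m1/m2.
by apply: l1; [exact: m2|exact: m2|exact: l2].
Qed.

Lemma monotone_if phi T1 T2 : monotone b T1 -> monotone b T2 ->
  monotone b (fun f s => if phi s then T1 f s else T2 f s).
Proof.
move=> [m1 l1] [m2 l2]; split => [f Df|f g Df Dg fg s].
- have /DomE D1 := m1 f Df; have /DomE D2 := m2 f Df.
  by apply/DomE => s; case: ifP.
- by case: ifP => _; [exact: l1|exact: l2].
Qed.

Lemma monotone_convex (p : R) T1 T2 : (0 <= p <= 1)%R ->
  monotone b T1 -> monotone b T2 ->
  monotone b (fun f s => p%:E * T1 f s + (1 - p)%:E * T2 f s).
Proof.
move=> p01 [m1 l1] [m2 l2]; split => [f Df|f g Df Dg fg s].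
- have /DomE D1 := m1 f Df; have /DomE D2 := m2 f Df.
  by apply/DomE => s; exact: drange_convex.
- by apply: dle_convex; [exact: p01|exact: l1|exact: l2].
Qed.

(** The fixed point for the larger [g] is a prefixed point of the functional for [f], so the
    minimality clause of Knaster-Tarski applies. *)
Lemma monotone_loop phi T : monotone b T ->
  monotone b (fun f => fixp b (Dom b) (fun Y s => if phi s then T Y s else f s)).
Proof.
move=> mT; pose Psi f Y s := if phi s then T Y s else f s.
have mPsi f : Dom b f -> monotone b (Psi f).
  by move=> Df; apply: monotone_if => //; exact: monotone_cst.
split => [f /mPsi/knaster_tarski[X fX _]|f g Df Dg fg].
  by rewrite (fixpE fX); move/is_fixE : fX => [].
have /knaster_tarski[X fX minX] := mPsi f Df.
have /knaster_tarski[Y fY _] := mPsi g Dg.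
rewrite (fixpE fX) (fixpE fY); move/is_fixE : fY => [DY PY _].
apply: minX => // s; rewrite -[X in dle b _ (X s)]PY /Psi.
by case: ifP => _; [exact: dle_refl|exact: fg].
Qed.

End monotone_closure.

(** * Continuity of the Lebesgue uniform assignment *)

Section uniform_assignment.
Context {R : realType} {V : finType}.
Local Notation S := (state R V).
Local Notation fct := (S -> \bar R).
Local Notation mu := (@lebesgue_measure R).
Variable b : bool.
Implicit Types (f g : fct) (x : V) (s : S).

Definition slice x f s (xi : R) : \bar R := f (update s x (to_nonneg xi)).

Lemma measurable_slice x f s (D : set R) : measurable_fun setT f ->
  measurable_fun D (slice x f s).
Proof.
move=> mf; apply: measurable_funTS.
apply: (measurableT_comp mf).
by apply: measurable_update_to_nonneg; [exact: measurable_cst|exact: measurable_id].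
Qed.

Lemma lebesgue_measure_unit : mu `[0%R, 1%R] = 1.
Proof. by rewrite lebesgue_measure_itv /= lte01 oppr0 adde0. Qed.

Lemma unif_int_dle x f g s : DomM b f -> DomM b g -> fle b f g ->
  dle b (unif_int x f s) (unif_int x g s).
Proof.
move=> /DomME[/DomE Df mf] /DomME[/DomE Dg mg] fg; rewrite /unif_int.
by case: b Df Dg fg => /= Df Dg fg; apply: ge0_le_integral => // [xi _|||xi _];
  rewrite ?(drange_ge0 (Df _)) ?(drange_ge0 (Dg _))//; try exact: measurable_slice;
  exact: fg.
Qed.

(** Tonelli: the integral is a section integral of a jointly measurable nonnegative function, once
    the restriction to the unit interval is absorbed into the integrand as an indicator. *)
Lemma measurable_unif_int x f : DomM b f -> measurable_fun setT (unif_int x f).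
Proof.
move=> /DomME[/DomE Df mf].
pose F (p : S * R) := f (update p.1 x (to_nonneg p.2)) *
  (\1_(`[0%R, 1%R]) p.2)%:E.
rewrite (_ : unif_int x f = fubini_F mu F); last first.
  apply/funext => s; rewrite /unif_int integral_mkcond /fubini_F.
  by apply: eq_integral => xi _; rewrite /F /= epatch_indic.
apply: measurable_fun_fubini_tonelli_F; last first.
  by move=> p; rewrite /F mule_ge0 ?(drange_ge0 (Df _))// lee_fin.
apply: emeasurable_funM.
  by apply: (measurableT_comp mf); apply: measurable_update_to_nonneg.
apply/measurable_EFinP; apply: (measurableT_comp _ measurable_snd).
by apply: measurable_indic.
Qed.

Lemma omega_continuous_unif_int x : omega_continuous b (@unif_int R V x).
Proof.
split => [f Df|f g Df Dg fg s|u f Du iu uf s].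
- apply/DomME; split; last exact: measurable_unif_int.
  move/DomME : Df => [/DomE Df mf]; apply/DomE => s; apply/andP; split.
    by apply: integral_ge0 => xi _; exact: drange_ge0 (Df _).
  case: b Df => //= Df.
  rewrite -[leRHS](mule1 1) -[X in _ * X]lebesgue_measure_unit -integral_cst//.
  apply: ge0_le_integral => // [xi _||xi _]; first exact: drange_ge0 (Df _).
    exact: measurable_slice.
  by have /andP[] := Df (update s x (to_nonneg xi)).
- exact: unif_int_dle.
- have mu_ n : measurable_fun (`[0%R, 1%R] : set R) (slice x (u n) s).
    by apply: measurable_slice; have /DomME[] := Du n.
  have u0 n t : 0 <= u n t.
    by have /DomM_Dom/DomE D := Du n; exact: drange_ge0 (D t).
  (* For [wp] the chain increases and monotone convergence applies. For [wlp] it decreases within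
     [0, 1], and the constant 1 is an integrable dominating function. *)
  case: b Du iu => Du iu.
    have h : unif_int x f s =
        \int[mu]_(xi in `[0%R, 1%R]) limn (fun n => slice x (u n) s xi).
      by apply: eq_integral => xi _; apply/esym/cvg_lim => //; exact: uf.
    rewrite h; apply: cvg_monotone_convergence => [//|//|n xi _|xi _].
      exact: u0.
    by apply: (dle_homo (b := true)) => n; exact: iu.
  apply: (@dominated_cvg _ _ _ mu _ _ (fun n => slice x (u n) s)
    (slice x f s) (cst 1)) => //.
  + by move=> xi _; exact: uf.
  + apply/integrableP; split; first exact: measurable_cst.
    rewrite (eq_integral (cst 1)) => [|xi _]; last by rewrite /= normr1.
    by rewrite integral_cst// mul1e [ltLHS]lebesgue_measure_unit ltry.
  + move=> n xi _; rewrite gee0_abs ?u0//.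
    by have /DomM_Dom/DomE D := Du n; have /andP[] := D (update s x (to_nonneg xi)).
Qed.

End uniform_assignment.

(** * Riemann sums and their comparison with the integral *)

Section riemann_assignment.
Context {R : realType} {V : finType}.
Local Notation S := (state R V).
Local Notation fct := (S -> \bar R).
Local Notation mu := (@lebesgue_measure R).
Variables (b : bool) (N : nat).
Hypothesis N_gt0 : (0 < N)%N.
Implicit Types (f g : fct) (x : V) (s : S).

(** Upper sums for [wp], lower sums for [wlp]: in the order [dle b] both take the least upper bound
    on each cell. *)
Definition unif_riemann x : fct -> fct :=
  if b then unif_upper N x else unif_lower N x.

Let cell_values x f s (i : nat) : set (\bar R) :=
  [set f (update s x xi) | xi in subinterval N i].

Lemma unif_riemannE x f s : unif_riemann x f s =
  (N%:R^-1)%:E * \sum_(i < N) dinf (~~ b) (cell_values x f s i).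
Proof. by rewrite /unif_riemann; case: b. Qed.

Let cell_values_neq0 x f s i : cell_values x f s i !=set0.
Proof.
have h : (0 <= i%:R / N%:R :> R)%R by rewrite divr_ge0.
exists (f (update s x (NngNum h))); exists (NngNum h) => //; rewrite /subinterval /=.
by rewrite lexx ler_wpM2r ?invr_ge0// ler_nat.
Qed.

Let cell_range x f s i : Dom b f -> drange b (dinf (~~ b) (cell_values x f s i)).
Proof.
move=> /DomE Df; apply: dsup_range; first exact: cell_values_neq0.
by move=> _ [xi _ <-].
Qed.

Lemma monotone_unif_riemann x : monotone b (unif_riemann x).
Proof.
have Ni0 : (0 <= N%:R^-1 :> R)%R by rewrite invr_ge0.
split => [f Df|f g Df Dg fg s].
  apply/DomE => s; rewrite unif_riemannE; apply/andP; split.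
    apply: mule_ge0; first by rewrite lee_fin.
    by apply: sume_ge0 => i _; apply: drange_ge0 (cell_range x s i Df).
  have := fun i => cell_range x s i Df; case: (b) => //= h.
  (* The bound 1 is the average of [N] ones, which allows a termwise comparison. *)
  have -> : 1 = (N%:R^-1)%:E * \sum_(i < N) 1 :> \bar R.
    by rewrite sumEFin -EFinM sumr_const card_ord mulVf// pnatr_eq0 -lt0n.
  apply: lee_wpmul2l; first by rewrite lee_fin.
  by apply: lee_sum => i _; have /andP[] := h i.
have h i : dle b (dinf (~~ b) (cell_values x f s i))
                 (dinf (~~ b) (cell_values x g s i)).
  rewrite -dleN; apply: dinf_glb => _ [xi xiN <-]; rewrite dleN.
  by apply: dle_trans (fg _) _; rewrite -dleN; apply: dinf_lb; exists xi.
rewrite !unif_riemannE; case: b h => /= h; apply: lee_wpmul2l;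
  by [rewrite lee_fin|apply: lee_sum].
Qed.

(** Induction on the number [k] of cells, for the interval from 0 to [k / N]; the claim is the case
    [k = N]. *)
Lemma integral_unit_split (h : R -> \bar R) : measurable_fun setT h ->
  (forall xi, 0 <= h xi) ->
  \int[mu]_(xi in `[0%R, 1%R]) h xi =
  \sum_(i < N) \int[mu]_(xi in `[(i%:R / N%:R)%R, (i.+1%:R / N%:R)%R]) h xi.
Proof.
move=> mh h0; have N0 : (N%:R != 0 :> R)%R by rewrite pnatr_eq0 -lt0n.
suff h_split k : \int[mu]_(xi in `[0%R, (k%:R / N%:R)%R]) h xi =
    \sum_(i < k) \int[mu]_(xi in `[(i%:R / N%:R)%R, (i.+1%:R / N%:R)%R]) h xi.
  by rewrite -h_split divff.
elim: k => [|k ih].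
  by rewrite mul0r set_itv1 integral_set1 big_ord0.
rewrite big_ord_recr /= -ih.
have k0 : (0 <= k%:R / N%:R :> R)%R by rewrite divr_ge0.
have kS : (k%:R / N%:R <= k.+1%:R / N%:R :> R)%R.
  by rewrite ler_wpM2r ?invr_ge0// ler_nat.
(* Cutting just before [k / N] makes the two pieces disjoint. The left piece loses its right
   endpoint, which is restored below as a null set. *)
rewrite (@itv_bndbnd_setU _ _ (BLeft 0%R) (BLeft (k%:R / N%:R)%R))//.
rewrite ge0_integral_setU//=.
- by rewrite integral_itv_bndo_bndc//; exact: measurable_funTS.
- exact: measurable_funTS.
- apply/disj_setPS => xi [] /=; rewrite !in_itv /= => /andP[_ xik] /andP[kxi _].
  by move: (lt_le_trans xik kxi); rewrite ltxx.
Qed.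

(** On each cell, of measure [1 / N], the integrand is bounded in [dle b] by the extremum that
    enters the Riemann sum; summing over the cells gives the claim. *)
Lemma unif_int_riemann x f : DomM b f -> fle b (unif_int x f) (unif_riemann x f).
Proof.
move=> Df s; have /DomME[/DomE rf mf] := Df; rewrite unif_riemannE.
have f0 xi : 0 <= slice x f s xi by exact: drange_ge0 (rf _).
have ms D : measurable_fun D (slice x f s) by exact: measurable_slice.
rewrite [unif_int _ _ _](integral_unit_split (ms setT) f0).
have r0 i : 0 <= dinf (~~ b) (cell_values x f s i).
  exact/drange_ge0/cell_range/DomM_Dom.
rewrite ge0_sume_distrr => [|i _]; last exact: r0.
pose cell i : set R := `[(i%:R / N%:R)%R, (i.+1%:R / N%:R)%R].
have mu_cell i : mu (cell i) = (N%:R^-1)%:E.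
  rewrite lebesgue_measure_itv /= lte_fin ltr_pM2r ?invr_gt0 ?ltr0n//.
  rewrite ltr_nat ltnSn -EFinD -mulrBl -natrB ?leqnSn// subSnn mul1r //.
have fc i xi : cell i xi ->
    dle b (slice x f s xi) (dinf (~~ b) (cell_values x f s i)).
  move=> cxi; rewrite -dleN; apply: dinf_lb; exists (to_nonneg xi) => //.
  move: cxi; rewrite /cell /subinterval /= in_itv /= => /andP[h1 h2].
  have xi0 : (0 <= xi)%R by apply: le_trans h1; rewrite divr_ge0.
  by rewrite ger0_norm// h1 h2.
have h i : dle b (\int[mu]_(xi in cell i) slice x f s xi)
    ((N%:R^-1)%:E * dinf (~~ b) (cell_values x f s i)).
  rewrite muleC -(mu_cell i) -integral_cst; last exact: measurable_itv.
  have mcell : measurable (cell i) by exact: measurable_itv.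
  by case: b fc r0 => /= fc r0; apply: ge0_le_integral => //;
    [exact: ms|exact: fc|exact: ms|exact: fc].
by case: b h => h; apply: lee_sum => i _; exact: h.
Qed.

End riemann_assignment.

(** * Exact against Riemann transformers, by induction on programs *)

Section transformers.
Context {R : realType} {V : finType}.
Local Notation S := (state R V).
Local Notation fct := (S -> \bar R).
Variables (b : bool) (N : nat).
Hypothesis N_gt0 : (0 < N)%N.
Implicit Types (f I : fct) (C : prog R V) (phi : {mfun S >-> bool}).

(** Unfolds to [wp] for [b = true] and to [wlp] for [b = false]; [riemann_transformer] unfolds
    likewise to [wp_upper N] and [wlp_lower N]. *)
Definition exact_transformer : prog R V -> fct -> fct :=
  transformer (dbot b) unif_int (fixp b (DomM b)).
Definition riemann_transformer : prog R V -> fct -> fct :=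
  transformer (dbot b) (unif_riemann b N) (fixp b (Dom b)).

Let ratr_prob (p : rat_prob) : (0 <= (ratr p : R) <= 1)%R.
Proof.
case: p => p /= /andP[p0 p1].
by rewrite ler0q p0 -[leRHS](rmorph1 (@ratr R)) ler_rat.
Qed.

(** Turning products with indicators into conditionals brings the rules into the form of the closure
    lemmas; an observation is a conditional with second branch 0. *)
Lemma transformer_observe d u (fp : (fct -> fct) -> fct) phi :
  transformer d u fp (Observe phi) = fun f s => if phi s then f s else 0.
Proof. by apply/funext => f; apply/funext => s /=; rewrite iverson_mul. Qed.

Lemma transformer_if d u (fp : (fct -> fct) -> fct) phi C1 C2 :
  transformer d u fp (If phi C1 C2) = fun f s =>
    if phi s then transformer d u fp C1 f s else transformer d u fp C2 f s.
Proof. by apply/funext => f; apply/funext => s /=; rewrite iverson_if. Qed.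

Lemma transformer_while d u (fp : (fct -> fct) -> fct) phi C :
  transformer d u fp (While phi C) = fun f =>
    fp (fun Y s => if phi s then transformer d u fp C Y s else f s).
Proof.
apply/funext => f /=; congr fp.
by apply/funext => Y; apply/funext => s; rewrite iverson_ifN.
Qed.

Lemma DomM0 : DomM b (cst 0 : fct).
Proof.
apply/DomME; split; last exact: measurable_cst.
by apply/DomE => s; exact: drange0.
Qed.

Lemma omega_continuous_exact_transformer C : omega_continuous b (exact_transformer C).
Proof.
elim: C => [||x E|phi|x|phi C1 ih1 C2 ih2|C1 ih1 p C2 ih2|C1 ih1 C2 ih2|phi C ih].
- exact: omega_continuous_id.
- exact/omega_continuous_cst/DomM_bot.
- apply: omega_continuous_subst; apply: measurable_update;
    first exact: measurable_id.
  exact: measurable_expr.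
- rewrite /exact_transformer transformer_observe.
  by apply: omega_continuous_if;
    [exact: omega_continuous_id|exact/omega_continuous_cst/DomM0].
- exact: omega_continuous_unif_int.
- by rewrite /exact_transformer transformer_if; apply: omega_continuous_if.
- by apply: omega_continuous_convex => //; exact: ratr_prob.
- exact: omega_continuous_comp.
- by rewrite /exact_transformer transformer_while; apply: omega_continuous_loop.
Qed.

Lemma monotone_riemann_transformer C : monotone b (riemann_transformer C).
Proof.
elim: C => [||x E|phi|x|phi C1 ih1 C2 ih2|C1 ih1 p C2 ih2|C1 ih1 C2 ih2|phi C ih].
- by [].
- exact/monotone_cst/DomM_Dom/DomM_bot.
- by split=> [f /DomE Df|f g _ _ fg s]; [apply/DomE => s; exact: Df|exact: fg].
- rewrite /riemann_transformer transformer_observe.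
  by apply: monotone_if => //; exact/monotone_cst/DomM_Dom/DomM0.
- exact: monotone_unif_riemann.
- by rewrite /riemann_transformer transformer_if; apply: monotone_if.
- by apply: monotone_convex => //; exact: ratr_prob.
- exact: monotone_comp.
- by rewrite /riemann_transformer transformer_while; apply: monotone_loop.
Qed.

(** Comparison takes place at the measurable [f], and monotonicity of the Riemann side then moves up
    to [g], which need not be measurable. The comparison for [C] is a premise so that an induction
    hypothesis can supply it. *)
Lemma exact_riemann_trans C f g : DomM b f -> Dom b g -> fle b f g ->
  (forall f, DomM b f ->
    fle b (exact_transformer C f) (riemann_transformer C f)) ->
  fle b (exact_transformer C f) (riemann_transformer C g).
Proof.
move=> Df Dg fg CP; apply: fle_trans (CP f Df) _.
by apply: (monotone_le (monotone_riemann_transformer C)) => //; exact: DomM_Dom.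
Qed.

Lemma exact_le_riemann C f : DomM b f ->
  fle b (exact_transformer C f) (riemann_transformer C f).
Proof.
elim: C f => [||x E|phi|x|phi C1 ih1 C2 ih2|C1 ih1 p C2 ih2|C1 ih1 C2 ih2|phi C ih]
  f Df.
- by move=> s; exact: dle_refl.
- by move=> s; exact: dle_refl.
- by move=> s; exact: dle_refl.
- by move=> s; exact: dle_refl.
- exact: unif_int_riemann.
- rewrite /exact_transformer /riemann_transformer !transformer_if => s.
  by case: ifP => _; [exact: ih1|exact: ih2].
- by move=> s; apply: dle_convex; [exact: ratr_prob|exact: ih1|exact: ih2].
(* The intermediate [riemann_transformer C2 f] may be non-measurable, so the hypothesis for [C1] is
   used at [exact_transformer C2 f] instead. *)
- have gC2 := omega_continuous_exact_transformer C2.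
  have mC2 := monotone_riemann_transformer C2.
  apply: (@exact_riemann_trans C1 (exact_transformer C2 f)
    (riemann_transformer C2 f)) => //.
  + exact: (omega_continuous_map gC2).
  + exact/(monotone_map mC2)/DomM_Dom.
  + exact: ih2.
- rewrite /exact_transformer /riemann_transformer !transformer_while.
  rewrite -/(exact_transformer C) -/(riemann_transformer C).
  set Psi := fun Y s => if phi s then riemann_transformer C Y s else f s.
  have /knaster_tarski[Y fY _] : monotone b Psi.
    apply: monotone_if; first exact: monotone_riemann_transformer.
    exact/monotone_cst/DomM_Dom.
  rewrite (fixpE fY); move/is_fixE : fY => [DY PY _].
  (* The Riemann fixed point [Y] serves as the possibly non-measurable bound in the fixed point
     induction for the exact loop. *)
  apply: omega_continuous_fix_ind => // [|Z DZ ZY s].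
    by apply: omega_continuous_if;
      [exact: omega_continuous_exact_transformer|exact: omega_continuous_cst].
  rewrite -[X in dle b _ (X s)]PY /Psi; case: ifP => _; last exact: dle_refl.
  exact: exact_riemann_trans.
Qed.

(** The invariant takes the place that the Riemann fixed point has in the loop case of
    [exact_le_riemann]; being prefixed is enough for the induction. *)
Lemma exact_loop_le_invariant phi C f I : DomM b f -> Dom b I ->
  fle b (fun s => if phi s then riemann_transformer C I s else f s) I ->
  fle b (exact_transformer (While phi C) f) I.
Proof.
move=> Df DI invI; rewrite /exact_transformer transformer_while.
apply: omega_continuous_fix_ind => // [|Z DZ ZI].
  by apply: omega_continuous_if;
      [exact: omega_continuous_exact_transformer|exact: omega_continuous_cst].
apply: fle_trans invI => s; case: ifP => _; last exact: dle_refl.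
by apply: exact_riemann_trans => // g; exact: exact_le_riemann.
Qed.

End transformers.

(** * Invariant rules for [wp], [wlp] and [cwp] *)

Lemma wp_le_superinvariant (R : realType) (V : finType)
    (phi : {mfun state R V >-> bool}) (B : prog R V) (N : nat)
    (I f : state R V -> \bar R) :
  (0 < N)%N -> expectations I -> expectations_meas f ->
  superinvariant N phi B f I -> exp_le (wp (While phi B) f) I.
Proof.
move=> N0 DI Df invI; apply: (@exact_loop_le_invariant R V true N) => // s.
by have := invI s; rewrite iverson_if.
Qed.

Lemma subinvariant_le_wlp (R : realType) (V : finType)
    (phi : {mfun state R V >-> bool}) (B : prog R V) (N : nat)
    (I f : state R V -> \bar R) :
  (0 < N)%N -> expectations1 I -> expectations1_meas f ->
  subinvariant N phi B f I -> exp_le I (wlp (While phi B) f).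
Proof.
move=> N0 DI Df invI; apply: (@exact_loop_le_invariant R V false N) => // s.
by have := invI s; rewrite iverson_if.
Qed.

Unset Implicit Arguments.

Theorem theorem6p2 (R : realType) (V : finType)
    (phi : {mfun state R V >-> bool}) (B : prog R V) (N N' : nat)
    (hN : (1 <= N)%N) (hN' : (1 <= N')%N) :
  [/\ (forall I f : state R V -> \bar R,
         expectations I -> expectations_meas f -> superinvariant N phi B f I ->
         exp_le (wp (While phi B) f) I),
      (forall I f : state R V -> \bar R,
         expectations1 I -> expectations1_meas f -> subinvariant N phi B f I ->
         exp_le I (wlp (While phi B) f)) &
      (forall I f J : state R V -> \bar R,
         expectations I -> expectations_meas f -> superinvariant N phi B f I ->
         expectations1 J -> subinvariant N' phi B (cst 1) J ->
         forall s : state R V, 0 < J s ->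
         exists2 v : \bar R, cwp (While phi B) f s = Some v & v <= I s / J s)].
Proof.
split; [by move=> *; exact: wp_le_superinvariant hN _ _ _|
        by move=> *; exact: subinvariant_le_wlp hN _ _ _|].
move=> I f J DI Df invI DJ invJ s Js0.
have wI := wp_le_superinvariant hN DI Df invI s.
have Jw : J s <= wlp (While phi B) (cst 1) s.
  apply: (subinvariant_le_wlp hN' DJ _ invJ).
  by split; [move=> t; rewrite lee01 lexx|exact: measurable_cst].
(* Positivity of [J s] passes to the denominator, so the conditional expectation is defined. *)
have w0 := lt_le_trans Js0 Jw.
rewrite /cwp gt_eqF//; eexists; first by [].
have [wp0 _] : expectations_meas (wp (While phi B) f).
  exact: (omega_continuous_map
    (@omega_continuous_exact_transformer R V true (While phi B))).
(* The numerator is enlarged first, from [wp] to [I]; then the denominator is decreased to [J s],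
   inversion being antitone on positive values. *)
apply: (le_trans (y := I s / wlp (While phi B) (cst 1) s)).
  by apply: lee_wpmul2r => //; rewrite inve_ge0 ltW.
by apply: lee_wpmul2l => //; rewrite lee_pV2 // inE ltW.
Qed.
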